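(* (In ZFC.) For every ordinal $n\le\omega$ there is a countable Hausdorff $n$-Toronto space.
   Context: For a topological space $X$ put $X^0=X$, let $X^{\alpha+1}$ be the set of non-isolated points of the subspace $X^\alpha$, and $X^\alpha=\bigcap_{\beta<\alpha}X^\beta$ for limit $\alpha$. $X$ is scattered if $X^\alpha=\emptyset$ for some ordinal $\alpha$; the least such $\alpha$ is the (Cantor-Bendixson) rank $r(X)$ of $X$. $X$ is an $\alpha$-Toronto space if $X$ is scattered of rank $\alpha$ and $X$ is homeomorphic to each of its subspaces of rank $\alpha$. *)

(* Defs.v *)
From HB Require Import structures.
From mathcomp Require Import all_boot all_order.
From mathcomp Require Import boolp classical_sets functions cardinality.
From mathcomp Require Import topology.

Set Implicit Arguments.
Unset Strict Implicit.
Unset Printing Implicit Defensive.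

Import Order.TTheory.
Local Open Scope order_scope.
Local Open Scope classical_set_scope.

(* Ordinals are represented by points of well-orders: a point [a] of a
   well-founded total order [W] stands for the order type of its initial
   segment [{b : W | b < a}].  Thus the points below [a] are exactly the
   ordinals smaller than [a]. *)
Definition wf_order {d : Order.disp_t} (W : orderType d) : Prop :=
  well_founded (fun a b : W => a < b).

Section CantorBendixson.
Context {d : Order.disp_t} {W : orderType d}.

Definition is_zero (a : W) : Prop := forall b : W, a <= b.

(* [is_succ b a] : [a = b + 1] *)
Definition is_succ (b a : W) : Prop := b < a /\ forall c : W, b < c -> a <= c.

Definition is_limit (a : W) : Prop :=
  ~ is_zero a /\ forall b : W, ~ is_succ b a.

(* Comparison of the ordinal [a] with the order type of a well-order [V]:
   strictly increasing maps between well-orders exist exactly when the order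
   type of the source is at most that of the target. *)
Definition ordinal_le {d' : Order.disp_t} (a : W) (V : orderType d') : Prop :=
  exists f : W -> V, forall b c : W, b < c -> c < a -> f b < f c.

Context (wfW : wf_order W) (X : topologicalType).

(* At zero both clauses are vacuous and the whole space is obtained; see
   [cb_derivative0], [cb_derivativeS] and [cb_derivative_limit]. *)
Definition cb_step (a : W) (D : forall b : W, b < a -> set X) : set X :=
  [set x |
    (forall (b : W) (ba : b < a), is_succ b a ->
       (D b ba `\` isolated (D b ba)) x) /\
    (is_limit a -> forall (b : W) (ba : b < a), D b ba x)].

(* The [a]-th Cantor-Bendixson derivative of [X]. *)
Definition cb_derivative : W -> set X :=
  Fix wfW (fun _ : W => set X) cb_step.

(* The least ordinal whose derivative is empty exists and is [a]. *)
Definition cb_rank_is (a : W) : Prop :=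
  cb_derivative a = set0 /\ forall b : W, b < a -> cb_derivative b <> set0.

Lemma cb_derivativeE (a : W) :
  cb_derivative a = cb_step (fun (b : W) (_ : b < a) => cb_derivative b).
Proof.
rewrite /cb_derivative Fix_eq // => b f g fg.
by congr cb_step; apply: functional_extensionality_dep => c;
  apply: functional_extensionality_dep => cb; exact: fg.
Qed.

Lemma cb_derivative0 (a : W) : is_zero a -> cb_derivative a = setT.
Proof.
move=> a0; rewrite cb_derivativeE; apply/seteqP; split => // x _.
by split => [b ba|[/(_ a0)]//]; move: (a0 b); rewrite leNgt ba.
Qed.

Lemma cb_derivativeS (b a : W) : is_succ b a ->
  cb_derivative a = cb_derivative b `\` isolated (cb_derivative b).
Proof.
move=> ab; rewrite cb_derivativeE; apply/seteqP; split => x.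
  by case=> /(_ b ab.1 ab).
move=> xb; split => [c ca ac|[_ /(_ b)]//].
suff -> : c = b by [].
apply/eqP; rewrite eq_le !leNgt; apply/andP; split; apply/negP => h.
  by move: (ab.2 _ h); rewrite leNgt ca.
by move: (ac.2 _ h); rewrite leNgt ab.1.
Qed.

Lemma cb_derivative_limit (a : W) : is_limit a ->
  cb_derivative a = \bigcap_(b in [set b : W | b < a]) cb_derivative b.
Proof.
move=> la; rewrite cb_derivativeE; apply/seteqP; split => x /=.
  by case=> _ /(_ la) h b; exact: h.
by move=> h; split => [b ba /la.2//|_ b ba]; exact: h.
Qed.

End CantorBendixson.

Arguments cb_derivative {d W} wfW X a.
Arguments cb_rank_is {d W} wfW X a.

Definition scattered (X : topologicalType) : Prop :=
  exists (d : Order.disp_t) (W : orderType d) (wfW : wf_order W) (a : W),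
    cb_derivative wfW X a = set0.

Definition homeomorphic (X Y : topologicalType) : Prop :=
  exists (f : X -> Y) (g : Y -> X),
    [/\ cancel f g, cancel g f, continuous f & continuous g].

(* [set_type A] carries the topology induced by the inclusion into [X]. *)
Definition toronto {d : Order.disp_t} {W : orderType d} (wfW : wf_order W)
    (a : W) (X : topologicalType) : Prop :=
  [/\ scattered X, cb_rank_is wfW X a &
    forall A : set X, cb_rank_is wfW (set_type A) a ->
      homeomorphic X (set_type A)].

(* Main.v *)
Require Import Defs.
From HB Require Import structures.
From mathcomp Require Import all_boot all_order.
From mathcomp Require Import boolp classical_sets functions cardinality.
From mathcomp Require Import topology.
From mathcomp Require Import zify.

(** Build countable spaces [X_k] of rank [k + 1] by recursion.  [X_0] is a
    point, and [X_(k+1)] consists of an apex and one clopen copy of [X_k] for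
    each finite sequence [p] of naturals; the neighbourhoods of the apex are the
    sets that contain it and all the copies outside a nowhere dense set of
    sequences.  Density refers to the extension order on finite sequences: a
    set of them is somewhere dense if, for some [s], every extension of [s] has
    an extension in the set.

    This ideal is what makes the spaces Toronto.  Any countable family indexed
    by sequences, with repetitions and omissions allowed, can be reindexed
    bijectively by all sequences without changing which subfamilies are
    somewhere dense, provided that the whole family is
    ([somewhere_dense_reindexing]).  The proof is a Cantor-Bernstein argument.
    Two consequences carry the theorem.

    - Absorption ([standard_absorbing]): adding to [X_k] countably many clopen
      copies of spaces [X_j] with [j < k] gives a space homeomorphic to [X_k].
      New copies of [X_(k-1)] are hung at the apex as a family with nowhere
      dense set of indices, and smaller spaces are absorbed by a single copy.
    - Subspaces ([standard_sub]): a subspace of [X_k] is either a copy of [X_k]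
      or a countable sum of spaces [X_j] with [j < k].  By induction the trace
      of the subspace on each copy below the apex is a countable sum, so the
      apex is a limit of a larger countable family of spaces.  If no type
      occurs at a somewhere dense set of indices, the apex is isolated.
      Otherwise let [j] be the largest one that does: the bigger
      pieces split off as a clopen set, the smaller ones are absorbed by
      those of type [j], and reindexing exhibits a copy of [X_(j+1)].

    A sum of spaces [X_j] with [j < k] has rank at most [k], so a subspace of
    [X_k] of full rank is a copy of [X_k]: [X_k] is [(k + 1)]-Toronto.  The empty
    space serves for rank [0].  For rank
    [omega] the space is the sum of all the [X_k].  A subspace of rank [omega]
    is a countable sum of [X_j]s with unbounded [j], and absorption lets two
    such sums be regrouped into sums along one and the same increasing sequence
    of types ([unbounded_sums_homs]). *)

Local Open Scope classical_set_scope.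
Set Implicit Arguments.
Unset Strict Implicit.

(** * The ideal of nowhere dense sets of finite sequences *)

Definition dense_below (A : set (seq nat)) (s : seq nat) : Prop :=
  forall t, exists w, A (s ++ t ++ w).

Definition somewhere_dense (A : set (seq nat)) : Prop :=
  exists s, dense_below A s.

Lemma dense_below_cat A s t : dense_below A s -> dense_below A (s ++ t).
Proof. by move=> As u; have [w Aw] := As (t ++ u); exists w; rewrite -catA (catA t). Qed.

Lemma sub_somewhere_dense A B :
  A `<=` B -> somewhere_dense A -> somewhere_dense B.
Proof. by move=> AB [s As]; exists s => t; have [w /AB] := As t; exists w. Qed.

Lemma somewhere_denseU A B :
  somewhere_dense (A `|` B) -> somewhere_dense A \/ somewhere_dense B.
Proof.
move=> [s ABs]; have [|nA] := pselect (somewhere_dense A); first by left.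
right; have [t At] : exists t, forall w, ~ A (s ++ t ++ w).
  apply: contrapT => h; apply: nA; exists s => t; apply: contrapT => h'.
  by apply: h; exists t => w Aw; apply: h'; exists w.
exists (s ++ t) => u; have [w] := ABs (t ++ u).
by rewrite -!catA; case=> [/At //|ABx]; exists w; rewrite -catA.
Qed.

Lemma somewhere_dense_setT : somewhere_dense setT.
Proof. by exists [::] => t; exists [::]; rewrite /setT. Qed.

Lemma somewhere_dense_set0 : ~ somewhere_dense set0.
Proof. by move=> [s /(_ [::])[]]. Qed.

Lemma somewhere_dense_set1 p : ~ somewhere_dense [set p].
Proof.
by move=> [s /(_ (0 :: p))[w]] /= /(congr1 size); rewrite size_cat /= size_cat; lia.
Qed.

Lemma nowhere_dense_sub A B :
  A `<=` B -> ~ somewhere_dense B -> ~ somewhere_dense A.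
Proof. by move=> /sub_somewhere_dense AB nB /AB. Qed.

Lemma nowhere_denseU A B :
  ~ somewhere_dense A -> ~ somewhere_dense B -> ~ somewhere_dense (A `|` B).
Proof. by move=> nA nB /somewhere_denseU[]. Qed.

(** Appending to each [pi i] a last letter of free choice makes the indexing
    injective without affecting density: the new sequence extends a
    sequence ending in a prescribed letter only if [pi i] extends what
    precedes that letter. *)
Lemma somewhere_dense_rcons (I : Type) (pi : I -> seq nat) (c : I -> nat)
    (A : set I) :
  somewhere_dense ((fun i => rcons (pi i) (c i)) @` A) <->
  somewhere_dense (pi @` A).
Proof.
split=> -[s As]; exists s => t.
  have [w [i Ai /= e]] := As (rcons t 0).
  have [v ev] : exists v, pi i = s ++ t ++ v; last by exists v, i.
  case/lastP: w e => [|w k]; last first.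
    by rewrite -!rcons_cat cat_rcons => /rcons_inj[-> _]; exists (0 :: w).
  by rewrite cats0 -rcons_cat => /rcons_inj[-> _]; exists [::]; rewrite cats0.
have [w [i Ai e]] := As t; exists (rcons w (c i)).
by exists i; rewrite // e -!rcons_cat.
Qed.

Section canonical.
Context (I : countType) (pi : I -> seq nat) (E : set I).

(** Below a node [s] where the family is dense, send [p] to an index [f p] whose
    sequence extends [s ++ p].  If the sequence of [f p] extends [s ++ q], then [p]
    extends [q] or is one of the finitely many prefixes of [q]; the latter
    are excluded by asking for a sequence long enough, and this is why [f]
    reflects density. *)
Lemma somewhere_dense_embedding : somewhere_dense (pi @` E) ->
  exists f : seq nat -> I, [/\ injective f, forall p, E (f p) &
    forall A, somewhere_dense ((pi \o f) @` A) <-> somewhere_dense A].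
Proof.
move=> [s Es].
have /choice[c cP] : forall t, exists i, E i /\ prefix (s ++ t) (pi i).
  by move=> t; have [w [i Ei e]] := Es t; exists i; rewrite e catA prefix_prefix.
pose w n : seq nat := odflt [::] (unpickle n).
have [F [FE Fw Fsize]] : exists F : nat -> I, [/\ forall n, E (F n),
    forall n, prefix (s ++ w n) (pi (F n)) &
    forall n, size (pi (F n)) < size (pi (F n.+1))].
  (* Padding with zeros makes the images strictly longer at each step, hence
     distinct. *)
  exists (fix F n := match n with 0 => c (w 0) | m.+1 =>
    c (w m.+1 ++ nseq (size (pi (F m))).+1 0) end).
  split=> [[|n]|[|n]|n]; [exact: (cP _).1 | exact: (cP _).1 | exact: (cP _).2 | |].
    apply: prefix_trans (cP _).2; rewrite catA; exact: prefix_prefix.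
  set m := size _; have := size_prefix (cP (w n.+1 ++ nseq m.+1 0)).2.
  by apply: leq_trans; rewrite !size_cat size_nseq addnA leq_addl.
have Fmono : {homo (fun n => size (pi (F n))) : m n / m < n}.
  exact: (homo_ltn ltn_trans).
have Finj : injective F.
  by move=> m n mn; case: (ltngtP m n) => // /Fmono; rewrite mn ltnn.
pose f (p : seq nat) := F (pickle p).
have fP p : prefix (s ++ p) (pi (f p)).
  by have := Fw (pickle p); rewrite /w pickleK.
exists f; split=> [|p|A]; [exact: inj_comp Finj (pcan_inj pickleK) | exact: FE|].
split=> [[t0 At]|[r Ar]]; last first.
  exists (s ++ r) => t; have [v Av] := Ar t.
  have /prefixP[u eu] := fP (r ++ t ++ v).
  by exists (v ++ u), (r ++ t ++ v) => //=; rewrite eu -!catA.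
have [v [p Ap /= ep]] := At [::].
have [r er] : exists r, dense_below ((pi \o f) @` A) (s ++ r).
  have /prefixP[u eu] := fP p; exists (p ++ u).
  by rewrite catA -eu ep; exact: dense_below_cat.
exists r => t; set q := r ++ t.
(* [M] bounds the lengths of the images of all the prefixes of [q]. *)
pose M := \max_(i < (size q).+1) size (pi (f (take i q))).
have [x [a Aa /= ea]] := er (t ++ nseq M.+1 0).
have /prefixP[u] := fP a; rewrite ea -!catA => /eqP; rewrite eqseq_cat // eqxx /=.
rewrite (catA r t) -/q => /eqP eu.
have [qa|aq] := leqP (size q) (size a).
  exists (drop (size q) a); suff -> : r ++ t ++ drop (size q) a = a by [].
  rewrite catA -/q -[RHS](cat_take_drop (size q)); congr cat.
  by have := congr1 (take (size q)) eu; rewrite take_size_cat // takel_cat.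
have ta : take (size a) q = a.
  by have := congr1 (take (size a)) eu; rewrite (takel_cat _ (ltnW aq)) (take_size_cat u erefl).
have := @leq_bigmax _ (fun i : 'I_(size q).+1 => size (pi (f (take i q))))
  (Ordinal (leqW aq)).
rewrite -/M /= ta ea !(size_cat, size_nseq) /= !(size_cat, size_nseq) => h.
lia.
Qed.

(** The families [pi] on [E] and the identity on all sequences embed in each
    other ([somewhere_dense_embedding], [somewhere_dense_rcons]), and the
    Cantor-Bernstein bijection is an embedding on each part of a partition in
    two; since somewhere density of a union is that of one of its parts, gluing
    the two embeddings is harmless. *)
Lemma somewhere_dense_reindexing : somewhere_dense (pi @` E) ->
  exists psi : seq nat -> I, [/\ injective psi, range psi = E &
    forall N, somewhere_dense ((pi \o psi) @` N) <-> somewhere_dense N].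
Proof.
move=> /somewhere_dense_embedding[f [finj fE fpos]].
pose g i := rcons (pi i) (pickle i).
have ginj : injective g.
  by move=> i j /rcons_inj[_ /(pcan_inj pickleK)].
(* The forward orbits under [g \o f] of the sequences outside the image of [g]. *)
pose K : set (seq nat) :=
  [set q | exists n q0, ~ (g @` E) q0 /\ q = iter n (g \o f) q0].
have Kgf q : K q -> K (g (f q)).
  by move=> [n [q0 [q0E ->]]]; exists n.+1, q0.
have /choice[h hP] : forall q, exists i, ~ K q -> E i /\ g i = q.
  move=> q.
  have [[i Ei <-]|qE] := pselect ((g @` E) q); first by exists i.
  by exists (f q) => -[]; exists 0, q.
pose psi q := if pselect (K q) then f q else h q.
have psiK q : K q -> psi q = f q by rewrite /psi; case: pselect.
have psiNK q : ~ K q -> psi q = h q by rewrite /psi; case: pselect.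
exists psi; split.
- have cross p q : K p -> ~ K q -> psi p <> psi q.
    move=> Kp Kq; rewrite psiK // psiNK // => e; apply: (Kq).
    by have [_ <-] := hP _ Kq; rewrite -e; exact: Kgf.
  move=> p q; have [Kp|Kp] := pselect (K p); have [Kq|Kq] := pselect (K q).
  + by rewrite !psiK // => /finj.
  + by move/(cross _ _ Kp Kq).
  + by move/esym/(cross _ _ Kq Kp).
  + by rewrite !psiNK // => e; rewrite -(hP _ Kp).2 e (hP _ Kq).2.
- apply/seteqP; split=> [_ [q _ <-]|i Ei].
    by have [Kq|Kq] := pselect (K q); [rewrite psiK|rewrite psiNK//; have [] := hP _ Kq].
  have [[n [q0 [q0E]]]|Kg] := pselect (K (g i)); last first.
    by exists (g i) => //; rewrite psiNK //; apply: ginj; rewrite (hP _ Kg).2.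
  case: n => [/= e|n]; first by case: q0E; rewrite -e; exists i.
  move=> /ginj ei; exists (iter n (g \o f) q0) => //; rewrite psiK //.
  by exists n, q0.
- have posK M : M `<=` K -> somewhere_dense ((pi \o psi) @` M) <-> somewhere_dense M.
    move=> MK; rewrite -(fpos M); suff -> : (pi \o psi) @` M = (pi \o f) @` M by [].
    by apply: eq_imagel => q /MK Kq /=; rewrite psiK.
  have posNK M : M `<=` ~` K -> somewhere_dense ((pi \o psi) @` M) <-> somewhere_dense M.
    move=> MK; rewrite -(image_comp psi pi) -(somewhere_dense_rcons pi pickle) image_comp.
    rewrite (_ : _ @` M = M) //; apply/seteqP; split => [_ [q Mq <-]|q Mq] /=.
      by rewrite psiNK; [rewrite -/(g _) (hP q _).2 //|]; exact: MK.
    by exists q => //; rewrite psiNK; [rewrite -/(g _) (hP q _).2 //|]; exact: MK.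
  move=> N; rewrite -[in X in X <-> _](setUIDK N K).
  rewrite -[in X in _ <-> X](setUIDK N K) image_setU.
  split=> /somewhere_denseU[].
  + by move/posK => /(_ (@subIsetr _ _ _)); apply: sub_somewhere_dense; left.
  + by move/posNK => h1; apply: sub_somewhere_dense (h1 _); [right|move=> q []].
  + by move/(posK _ (@subIsetr _ _ _)); apply: sub_somewhere_dense; left.
  + by move=> h1; apply: sub_somewhere_dense ((posNK _ _).2 h1); [right|move=> q []].
Qed.

End canonical.

(** * Cones over countable families of clopen pieces *)

Section Relative.
Context {T : topologicalType}.
Implicit Types A B C V : set T.

(** Openness in the subspace topology of [A], phrased with neighbourhoods of the
    ambient space: all the subspaces of one space are handled inside it. *)
Definition rel_open A C : Prop :=
  C `<=` A /\ forall x, C x -> nbhs x [set y | A y -> C y].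

Lemma rel_open_sub A B C : C `<=` B -> B `<=` A -> rel_open A C -> rel_open B C.
Proof.
move=> CB BA [_ Co]; split=> // x /Co; apply: filterS => y yC /BA; exact: yC.
Qed.

Lemma rel_open_trans A B C : rel_open A B -> rel_open B C -> rel_open A C.
Proof.
move=> [BA Bo] [CB Co]; split=> [x /CB/BA//|x Cx].
by apply: filterS2 (Bo x (CB _ Cx)) (Co x Cx) => y h1 h2 /h1/h2.
Qed.

Lemma rel_open_setI A B C : B `<=` A -> rel_open A C -> rel_open B (B `&` C).
Proof.
move=> BA [CA Co]; split=> [x []//|x [Bx Cx]].
by apply: filterS (Co x Cx) => y yC By; split; [|exact/yC/BA].
Qed.

Lemma rel_open0 A : rel_open A set0. Proof. by split. Qed.

Definition pieces (I : Type) A (C : I -> set T) : Prop :=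
  (forall i j x, C i x -> C j x -> i = j) /\ forall i, rel_open A (C i).

Definition sum_of (I : Type) A (C : I -> set T) : Prop :=
  pieces A C /\ forall x, A x -> exists i, C i x.

Lemma pieces_group (I J : Type) A (C : I -> set T) (r : I -> J) :
  pieces A C -> pieces A (fun j => [set y | exists2 i, r i = j & C i y]).
Proof.
move=> [Cd Co]; split=> [j j' x [i <- ix] [i' <- /(Cd _ _ _ ix) ->]//|j].
split=> [x [i _ /(Co i).1]//|x [i ij ix]].
by apply: filterS ((Co i).2 x ix) => y iy /iy; exists i.
Qed.

Lemma sum_of_fiber (I J : Type) A (C : I -> set T) (r : I -> J) j :
  pieces A C -> sum_of [set y | exists2 i, r i = j & C i y]
                       (fun i => [set y | r i = j /\ C i y]).
Proof.
move=> [Cd Co]; split=> [|x [i ij ix]]; last by exists i.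
split=> [i i' x [_ ix] [_ /(Cd _ _ _ ix)]//|i].
split=> [x [ij ix]|x [ij ix]]; first by exists i.
apply: filterS ((Co i).2 x ix) => y iy [i' i'j i'y]; split=> //.
by apply: iy; exact: (Co i').1 i'y.
Qed.

Lemma pieces_setI (I : Type) A B (C : I -> set T) :
  A `<=` B -> pieces B C -> pieces A (fun i => A `&` C i).
Proof.
move=> AB [Cd Co]; split=> [i j x [_ ix] [_]|i]; first exact: Cd ix.
exact: rel_open_setI AB (Co i).
Qed.

Lemma pieces_pieces (I J : Type) A (C : I -> set T) (D : I -> J -> set T) :
  pieces A C -> (forall i, pieces (C i) (D i)) ->
  pieces A (fun ij => D ij.1 ij.2).
Proof.
move=> [Cd Co] Dp; split=> [[i j] [i' j'] x ix ix'|[i j]]; last first.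
  exact: rel_open_trans (Co i) ((Dp i).2 j).
have e := Cd _ _ _ (((Dp i).2 j).1 _ ix) (((Dp i').2 j').1 _ ix').
by rewrite /= -e in ix' *; congr pair; exact: (Dp i).1 ix ix'.
Qed.

(** The pieces [C i] converge to the apex [x] along the dual filter of the ideal
    of the index sets with nowhere dense image under [pi]. *)
Record cone (I : Type) (pi : I -> seq nat) (x : T) (C : I -> set T) A : Prop :=
  Cone {
    cone_pieces : pieces A C;
    cone_apex : A x;
    cone_cover : forall y, A y -> y = x \/ exists i, C i y;
    cone_apexN : forall i, ~ C i x;
    cone_nbhs : forall N, ~ somewhere_dense N ->
      nbhs x [set y | A y -> y = x \/ exists2 i, ~ N (pi i) & C i y];
    cone_cvg : forall V, nbhs x V ->
      ~ somewhere_dense (pi @` [set i | ~ C i `<=` V]) }.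

(** The subsets whose subspace topology makes them copies of the space [X_k]
    described above. *)
Fixpoint standard (k : nat) A : Prop :=
  match k with
  | 0 => exists x, A = [set x]
  | k'.+1 => exists x (C : seq nat -> set T), cone id x C A /\
      forall p, standard k' (C p)
  end.

Lemma standard_neq0 k A : standard k A -> A !=set0.
Proof.
by case: k => [[x ->]|k [x [C [/cone_apex Ax _]]]]; exists x.
Qed.

(** The empty set is included so that families of pieces can be cut down without
    changing their index type. *)
Definition lower_standard (k : nat) A : Prop :=
  A = set0 \/ exists2 j, j < k & standard j A.

Lemma lower_standard0 k : lower_standard k set0. Proof. by left. Qed.

Lemma lower_standardS k A :
  lower_standard k.+1 A -> ~ standard k A -> lower_standard k A.
Proof.
move=> [->|[j jk jA] nA]; first by left.
right; exists j => //; rewrite ltn_neqAle -ltnS jk andbT.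
by apply/eqP => e; apply: nA; rewrite -e.
Qed.

Lemma lower_standard_leq j k A :
  j <= k -> lower_standard j A -> lower_standard k A.
Proof.
by move=> jk [->|[i ij iA]]; [left|right; exists i => //; exact: leq_trans jk].
Qed.

Definition absorbing (k : nat) : Prop :=
  forall (I : countType) (C : I -> set T) (i0 : I) A, sum_of A C ->
    standard k (C i0) ->
    (forall i, i <> i0 -> lower_standard k (C i)) -> standard k A.

(** The pieces of type [k] form a somewhere dense family, hence can be reindexed
    by all sequences [p].  A piece of smaller type with index [i] is merged into
    the piece of type [k] that received the index [pi i]; this respects nowhere
    density because [pi i] is already the sequence attached to [i]. *)
Lemma cone_absorb k : absorbing k ->
  forall (I : countType) (pi : I -> seq nat) x (C : I -> set T) A,
    cone pi x C A -> (forall i, lower_standard k.+1 (C i)) ->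
    somewhere_dense (pi @` [set i | standard k (C i)]) -> standard k.+1 A.
Proof.
move=> absk I pi x C A cA Clow.
set E := [set i | _] => /somewhere_dense_reindexing[psi [psi_inj psiE psi_pos]].
have Epsi p : E (psi p) by rewrite -psiE; exists p.
have /choice[r rP] : forall i, exists p,
    (E i /\ psi p = i) \/ (~ E i /\ p = pi i).
  move=> i; have [Ei|nEi] := pselect (E i); last by exists (pi i); right.
  by have := Ei; rewrite -{1}psiE => -[p _ e]; exists p; left.
have r_psi p : r (psi p) = p.
  by have [[_ /psi_inj]//|[/(_ (Epsi p))]] := rP (psi p).
exists x, (fun p => [set y | exists2 i, r i = p & C i y]); split; last first.
  move=> p; apply: (absk I _ (psi p) _ (sum_of_fiber r p (cone_pieces cA))).
    rewrite (_ : mkset _ = C (psi p)); first exact: (Epsi p).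
    by apply/seteqP; split=> y //= [].
  move=> i ip; have [rip|rip] := pselect (r i = p); last first.
    rewrite (_ : mkset _ = set0); first exact: lower_standard0.
    by apply/seteqP; split=> y //= [].
  rewrite (_ : mkset _ = C i); last by apply/seteqP; split=> y //= [].
  apply: lower_standardS => // Ei; apply: ip; have [[_]|[]//] := rP i.
  by rewrite rip.
split; first exact: pieces_group (cone_pieces cA).
- exact: cone_apex cA.
- move=> y /(cone_cover cA)[|[i iy]]; [by left|right].
  by exists (r i), i.
- by move=> p [i _ /(cone_apexN cA)].
- move=> N nN.
  have nN' : ~ somewhere_dense (N `|` (pi \o psi) @` N).
    by apply: nowhere_denseU => //; rewrite psi_pos.
  apply: filterS (cone_nbhs cA nN') => y yP /yP[|[i iN iy]]; [by left|right].
  exists (r i); last by exists i.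
  move=> Nri; apply: iN; have [[_ e]|[_ <-]] := rP i; last by left.
  by right; exists (r i) => //=; rewrite e.
- move=> V /(cone_cvg cA); set M := pi @` _ => nM.
  rewrite image_id.
  apply: nowhere_dense_sub (nowhere_denseU nM _); last first.
    have : ~ somewhere_dense ((pi \o psi) @` [set p | M (pi (psi p))]).
      by apply: nowhere_dense_sub nM => _ [p Mp <-].
    by rewrite psi_pos; exact.
  move=> p /= /existsNP[y /not_implyP[[i ri iy] nVy]].
  have Mi : M (pi i) by exists i => // /(_ _ iy).
  by have [[_ e]|[_ e]] := rP i; [right; rewrite /= -ri e|left; rewrite -ri e].
Qed.

(** Hang the additional pieces at the apex of the piece of type [k], all over the
    same sequence [[::]]: the singleton of [[::]] is nowhere dense, so the
    neighbourhoods of the apex do not change. *)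
Lemma standard_absorbing k : absorbing k.
Proof.
elim: k => [|k IH] I C i0 A [[Cd Co] Acov] /= Ci0 Clow.
  have [x Cx] := Ci0; exists x; rewrite -Cx; apply/seteqP; split=> [y Ay|].
    have [i iy] := Acov _ Ay; have [<-//|/Clow[Ci|[]//]] := pselect (i = i0).
    by rewrite Ci in iy.
  exact: (Co i0).1.
have [x [Cp [cC typC]]] := Ci0.
pose C' (j : seq nat + I) : set T :=
  match j with inl p => Cp p | inr i => if i == i0 then set0 else C i end.
pose pi (j : seq nat + I) := if j is inl p then p else [::].
have [[Cpd Cpo] Ax CC Cx Cn Ccvg] := cC.
apply: (@cone_absorb k IH _ pi x C').
- split.
  + split=> [[p|i] [q|j] y /=|[p|i]].
    * by move=> h /(Cpd _ _ _ h) ->.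
    * by case: eqP => // jn /(Cpo p).1 h1 /(Cd _ _ _ h1) e; case: jn.
    * by case: eqP => // jn h /(Cpo q).1 /(Cd _ _ _ h) e; case: jn.
    * by case: eqP => // _; case: eqP => // _ h /(Cd _ _ _ h) ->.
    * exact: rel_open_trans (Co i0) (Cpo p).
    * by rewrite /=; case: eqP => // _; exact: rel_open0.
  + exact: (Co i0).1.
  + move=> y /Acov[i]; have [->|ni] := eqVneq i i0.
      by move=> /CC[|[p py]]; [left|right; exists (inl p)].
    by move=> iy; right; exists (inr i) => /=; rewrite (negbTE ni).
  + move=> [p|i] /=; first exact: Cx.
    case: eqP => [_ []|ni ix]; apply: ni; exact: (Cd _ _ _ ix Ax).
  + move=> N nN; apply: filterS2 ((Co i0).2 _ Ax) (Cn _ nN) => y h1 h2 /h1/h2.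
    by case=> [|[p pN py]]; [left|right; exists (inl p)].
  + move=> V /Ccvg nM; apply: nowhere_dense_sub (nowhere_denseU nM (@somewhere_dense_set1 [::])).
    move=> _ [[p|i] h /= <-]; [left|by right].
    by exists p.
- move=> [p|i] /=; first by right; exists k.
  by case: eqP => [_|/Clow//]; exact: lower_standard0.
- apply: sub_somewhere_dense somewhere_dense_setT => p _; exists (inl p) => //=; exact: typC.
Qed.

Lemma sum_of_nat (I : countType) A (C : I -> set T) (P : set T -> Prop) :
  P set0 -> sum_of A C -> (forall i, P (C i)) ->
  exists D : nat -> set T, sum_of A D /\ forall n, P (D n).
Proof.
move=> P0 [[Cd Co] Acov] CP.
exists (fun n => if pickle_inv n is Some i then C i else set0); split; last first.
  by move=> n; case: pickle_inv.
split=> [|x /Acov[i ix]]; last by exists (pickle i); rewrite pickleK_inv.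
split=> [m n x|n]; last by case: pickle_inv => // *; exact: rel_open0.
have := @pickle_invK I m; have := @pickle_invK I n.
case: pickle_inv => //= i <-; case: pickle_inv => //= j <- jx ix.
by rewrite (Cd _ _ _ ix jx).
Qed.

Definition lower_sum (k : nat) A : Prop :=
  exists C : nat -> set T, sum_of A C /\ forall i, lower_standard k (C i).

Lemma lower_sumP (I : countType) k A (C : I -> set T) :
  sum_of A C -> (forall i, lower_standard k (C i)) -> lower_sum k A.
Proof. exact: sum_of_nat (lower_standard0 k). Qed.

Lemma standard_small_sum k A : standard k A -> lower_sum k.+1 A.
Proof.
move=> kA; apply: (@lower_sumP unit _ _ (fun=> A)); last by right; exists k.
split=> [|y Ay]; last by exists tt.
by split=> [[] [] //|_]; split=> // y Ay; apply: filterE => z.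
Qed.

Lemma lower_sum_leq j k A : j <= k -> lower_sum j A -> lower_sum k A.
Proof.
move=> jk [C [Csum Clow]]; exists C; split=> // i; exact: lower_standard_leq (Clow i).
Qed.

(** Let [m] be least such that the pieces that are not of type less than [m] form a
    nowhere dense family.  Those pieces form a clopen set away from the apex, and
    the rest is standard of type [m], by [cone_absorb] applied to the pieces
    of type [m - 1] when [m > 0]. *)
Lemma cone_dichotomy k (I : countType) (pi : I -> seq nat) x (C : I -> set T) A :
  cone pi x C A -> (forall i, lower_standard k.+1 (C i)) ->
  standard k.+1 A \/ lower_sum k.+1 A.
Proof.
move=> cA Clow; pose S m := [set i | ~ lower_standard m (C i)].
have [[Cd Co] Ax Acov xN An Acvg] := cA.
have Sk : S k.+1 = set0 by apply/seteqP; split=> i //= /(_ (Clow i)).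
have exm : exists m, ~ somewhere_dense (pi @` S m).
  by exists k.+1; rewrite Sk image_set0; exact: somewhere_dense_set0.
have [m nSm mmin] : exists2 m, ~ somewhere_dense (pi @` S m) &
    forall m', m' < m -> somewhere_dense (pi @` S m').
  have exm' : exists m, `[< ~ somewhere_dense (pi @` S m) >].
    by have [m h] := exm; exists m; exact/asboolP.
  case: (ex_minnP exm') => m /asboolP h mmin; exists m => // m' m'm.
  apply: contrapT => h'; have := mmin m'; rewrite leqNgt m'm => /(_ _)/negP[] //.
  exact/asboolP.
have mk : m <= k.+1.
  rewrite leqNgt; apply/negP => /mmin; rewrite Sk image_set0; exact: somewhere_dense_set0.
pose C1 i := [set y | lower_standard m (C i) /\ C i y].
have C1E i : lower_standard m (C i) -> C1 i = C i.
  by move=> h; apply/seteqP; split=> y //= [].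
have C1N i : ~ lower_standard m (C i) -> C1 i = set0.
  by move=> h; apply/seteqP; split=> y //= [].
(* [A1] is the apex together with all the pieces of type less than [m]. *)
pose A1 := [set y | y = x \/ exists i, C1 i y].
have A1A : A1 `<=` A by move=> y [->//|[i [_ /(Co i).1]]].
have cA1 : cone pi x C1 A1.
  split.
  - split=> [i j y [_ iy] [_ /(Cd _ _ _ iy)]//|i].
    have [h|/C1N ->] := pselect (lower_standard m (C i)); last exact: rel_open0.
    rewrite C1E //; apply: rel_open_sub (Co i) => // y iy; right; exists i.
    by rewrite C1E.
  - by left.
  - by move=> y.
  - by move=> i [_ /xN].
  - move=> N nN; apply: filterS (An N nN) => y h yA1.
    have /h[|[i Ni iy]] := A1A _ yA1; [by left|right].
    case: yA1 => [yx|[j [jl jy]]]; first by rewrite yx in iy; case: (xN i).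
    by exists i => //; rewrite (Cd _ _ _ iy jy) in Ni *.
  - move=> V /Acvg; apply: nowhere_dense_sub => _ [i h <-]; exists i => // h'.
    by apply: h => y [_ /h'].
have typA1 : standard m A1.
  case: m nSm mmin mk C1 C1E C1N @A1 A1A cA1 => [|m] nSm mmin mk C1 C1E C1N A1 A1A cA1.
    exists x; apply/seteqP; split=> y /=; last by left.
    case=> // -[i]; have [l0|/C1N-> //] := pselect (lower_standard 0 (C i)).
    by rewrite C1E //; case: l0 => [->//|[]].
  apply: (cone_absorb (@standard_absorbing m) cA1) => [i|].
    have [h|/C1N ->] := pselect (lower_standard m.+1 (C i)); last exact: lower_standard0.
    by rewrite C1E.
  have : somewhere_dense (pi @` ([set i | standard m (C1 i)] `|` S m.+1)).
    apply: sub_somewhere_dense (mmin _ (ltnSn m)) => _ [i Si <-]; exists i => //.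
    have [h|h] := pselect (lower_standard m.+1 (C i)); [left => /=|by right].
    rewrite C1E //; apply: contrapT => /(lower_standardS h); exact: Si.
  by rewrite image_setU => /somewhere_denseU[].
have [mk1|mnk] := eqVneq m k.+1.
  left; rewrite -mk1; suff -> : A = A1 by [].
  apply/seteqP; split=> // y /Acov[|[i iy]]; [by left|right].
  by exists i; split=> //; rewrite mk1.
have A1o : rel_open A A1.
  split=> // y [->|[i [il iy]]].
    apply: filterS (An _ nSm) => z h /h[|[i iS iz]]; [by left|right].
    by exists i; split=> //; apply: contrapT => il; apply: iS; exists i.
  by apply: filterS ((Co i).2 y iy) => z h /h iz; right; exists i.
right; apply: (@lower_sumP (option I) _ _
  (fun o => if o is Some i then [set y | ~ lower_standard m (C i) /\ C i y]
            else A1)).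
  have A1C i y : ~ lower_standard m (C i) -> C i y -> ~ A1 y.
    move=> il iy [yx|[j [jl jy]]]; first by rewrite yx in iy; case: (xN i).
    by apply: il; rewrite (Cd _ _ _ iy jy).
  split; first split.
  - move=> [i|] [j|] y //=.
    + by move=> [_ iy] [_ /(Cd _ _ _ iy) ->].
    + by move=> [il iy] /(A1C _ _ il iy).
    + by move=> h [il iy]; case: (A1C _ _ il iy).
  - move=> [i|] //; have [il|il] := pselect (lower_standard m (C i)).
      rewrite (_ : mkset _ = set0); first exact: rel_open0.
      by apply/seteqP; split=> y //= [].
    by rewrite (_ : mkset _ = C i) //; apply/seteqP; split=> y //= [].
  - move=> y /Acov[->|[i iy]]; first by exists None; left.
    have [il|il] := pselect (lower_standard m (C i)); last by exists (Some i).
    by exists None; right; exists i.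
move=> [i|]; last by right; exists m => //; rewrite ltn_neqAle mnk.
have [il|il] := pselect (lower_standard m (C i)).
  by left; apply/seteqP; split=> y //= [].
by rewrite (_ : mkset _ = C i) //; apply/seteqP; split=> y //= [].
Qed.

Lemma standard_sub k A B :
  standard k B -> A `<=` B -> standard k A \/ lower_sum k A.
Proof.
elim: k A B => [|k IH] A B.
  move=> [x ->] Ax; have [A0|/set0P[y Ay]] := eqVneq A set0.
    right; exists (fun=> set0); split=> [|i]; last exact: lower_standard0.
    by split=> [|y]; [split=> // i; exact: rel_open0|rewrite A0].
  by left; exists x; apply/seteqP; split=> // z ->; rewrite -(Ax _ Ay).
move=> [x [C [[[Cd Co] Bx Bcov xN Bn Bcvg] typC]]] AB.
have /choice[D DP] : forall p, lower_sum k.+1 (A `&` C p).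
  move=> p; have [|] := IH _ _ (typC p) (@subIsetr _ A (C p)).
    exact: standard_small_sum.
  exact/lower_sum_leq/leqnSn.
pose F (i : seq nat * nat) := D i.1 i.2.
have Fsub i : F i `<=` A `&` C i.1 by exact: ((DP i.1).1.1.2 i.2).1.
have Fpieces : pieces A F.
  by apply: pieces_pieces (pieces_setI AB (conj Cd Co)) _ => p; exact: (DP p).1.1.
have Fcov y : A y -> y = x \/ exists i, F i y.
  move=> Ay; have [|[p py]] := Bcov _ (AB _ Ay); [by left|right].
  by have [n ny] := (DP p).1.2 y (conj Ay py); exists (p, n).
have Flow i : lower_standard k.+1 (F i) by exact: (DP i.1).2.
have [Ax|nAx] := pselect (A x); last first.
  right; apply: (lower_sumP (C := F)) => //; split=> // y Ay.
  by case: (Fcov _ Ay) => // yx; rewrite yx in Ay.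
apply: (@cone_dichotomy k _ fst x F) => //; split=> //.
- by move=> [p n] /Fsub[_ /xN].
- move=> N nN; apply: filterS (Bn _ nN) => y h Ay.
  case: (h (AB _ Ay)) => [|[p Np py]]; [by left|right].
  by have [n ny] := (DP p).1.2 y (conj Ay py); exists (p, n).
- move=> V /Bcvg; rewrite image_id; apply: nowhere_dense_sub => _ [[p n] h <-] /= CV.
  by apply: h => y /Fsub[_ /CV].
Qed.
End Relative.

(** * Homeomorphisms between subsets of one space *)

Section Homeomorphism.
Context {T : topologicalType}.
Implicit Types (A B : set T) (f g : T -> T).

Definition homf A B f g : Prop :=
  forall x, A x -> [/\ B (f x), g (f x) = x &
    forall V, nbhs (f x) V -> nbhs x [set y | A y -> V (f y)]].

(** The maps are total on [T], which makes them easy to glue; only their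
    values on [A] and on [B] matter. *)
Definition homs A B : Prop := exists f g, homf A B f g /\ homf B A g f.

Lemma amalgam (I : Type) (C : I -> set T) (f : I -> T -> T) :
  (forall i j x, C i x -> C j x -> i = j) ->
  exists F, forall i x, C i x -> F x = f i x.
Proof.
move=> Cd.
suff /choice[F FP] : forall x, exists y, forall i, C i x -> y = f i x.
  by exists F => i x; exact: FP.
move=> x; have [[i ix]|nx] := pselect (exists i, C i x).
  by exists (f i x) => j /(Cd _ _ _ ix) ->.
by exists x => i ix; case: nx; exists i.
Qed.

Lemma homf_piece A B C D (f g F G : T -> T) :
  rel_open A C -> D `<=` B -> homf C D f g ->
  (forall x, C x -> F x = f x) -> (forall y, D y -> G y = g y) ->
  forall x, C x -> [/\ B (F x), G (F x) = x &
    forall V, nbhs (F x) V -> nbhs x [set y | A y -> V (F y)]].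
Proof.
move=> [_ Co] DB fg FE GE x Cx; have [Dfx gf fc] := fg x Cx.
rewrite FE // GE //; split=> // [|V /fc]; first exact: DB.
by apply: filterS2 (Co x Cx) => y h1 h2 /h1 Cy; rewrite FE //; exact: h2.
Qed.

Lemma sum_homs (I : Type) A B (C D : I -> set T) :
  sum_of A C -> sum_of B D -> (forall i, homs (C i) (D i)) -> homs A B.
Proof.
move=> [[Cd Co] Acov] [[Dd Do] Bcov] /choice[f /choice[g fg]].
have [F FE] := amalgam f Cd; have [G GE] := amalgam g Dd.
exists F, G; split.
- move=> x /Acov[i ix].
  by apply: (homf_piece (Co i) (Do i).1 (fg i).1 (FE i) (GE i)).
- move=> x /Bcov[i ix].
  by apply: (homf_piece (Do i) (Co i).1 (fg i).2 (GE i) (FE i)).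
Qed.

(** Continuity at the apex needs only that corresponding pieces carry the same
    index sequence, whatever the maps between the pieces are. *)
Lemma cone_homf_apex (I : Type) (pi : I -> seq nat) a b A B (C D : I -> set T)
    (F : T -> T) : cone pi a C A -> cone pi b D B -> F a = b ->
  (forall i x, C i x -> D i (F x)) ->
  forall V, nbhs b V -> nbhs a [set y | A y -> V (F y)].
Proof.
move=> cA cB Fa FCD V nV.
apply: filterS (cone_nbhs cA (cone_cvg cB nV)) => y h /h[->|[i iV iy]].
  by rewrite Fa; exact: nbhs_singleton.
apply: contrapT => nVy; apply: iV; exists i => // /(_ _ (FCD _ _ iy)); exact: nVy.
Qed.

Lemma cone_homs (I : Type) (pi : I -> seq nat) a b A B (C D : I -> set T) :
  cone pi a C A -> cone pi b D B -> (forall i, homs (C i) (D i)) -> homs A B.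
Proof.
move=> cA cB /choice[f /choice[g fg]].
pose addpt x (E : I -> set T) o := if o is Some i then E i else [set x].
pose addfun y (h : I -> T -> T) o := if o is Some i then h i else fun=> y.
have addd x E : (forall i j z, E i z -> E j z -> i = j) -> (forall i, ~ E i x) ->
    forall o o' z, addpt x E o z -> addpt x E o' z -> o = o'.
  move=> Ed xE [i|] [j|] z //=.
  - by move=> /Ed h /h ->.
  - by move=> h zx; rewrite zx in h; case: (xE i).
  - by move=> -> /xE.
have [[Cd Co] Aa Acov aC _ _] := cA; have [[Dd Do] Bb Bcov bD _ _] := cB.
have [F FE] := amalgam (addfun b f) (addd _ _ Cd aC).
have [G GE] := amalgam (addfun a g) (addd _ _ Dd bD).
have Fa : F a = b by rewrite (FE None).
have Gb : G b = a by rewrite (GE None).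
have FC i x : C i x -> D i (F x).
  by move=> ix; rewrite (FE (Some i)) //; have [] := (fg i).1 x ix.
have GD i x : D i x -> C i (G x).
  by move=> ix; rewrite (GE (Some i)) //; have [] := (fg i).2 x ix.
exists F, G; split.
- move=> x /Acov[->|[i ix]].
    by rewrite Fa; split=> //; exact: (cone_homf_apex cA cB Fa FC).
  by apply: (homf_piece (Co i) (Do i).1 (fg i).1 (FE (Some i)) (GE (Some i))).
- move=> x /Bcov[->|[i ix]].
    by rewrite Gb; split=> //; exact: (cone_homf_apex cB cA Gb GD).
  by apply: (homf_piece (Do i) (Co i).1 (fg i).2 (GE (Some i)) (FE (Some i))).
Qed.

Lemma standard_homs k A B : standard k A -> standard k B -> homs A B.
Proof.
elim: k A B => [|k IH] A B.
  move=> [a ->] [b ->]; exists (fun=> b), (fun=> a).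
  by split=> _ ->; split=> // V /nbhs_singleton Vx; apply: filterE => z.
move=> [a [C [cA typC]]] [b [D [cB typD]]].
by apply: (cone_homs cA cB) => p; exact: IH (typC p) (typD p).
Qed.

(** Every piece outside the sequence [s] is absorbed by some [C (s n)] of larger
    type, which exists because the types along [s] are unbounded. *)
Lemma sum_regroup A (C : nat -> set T) (tau : nat -> nat) (s : nat -> nat) :
  sum_of A C -> (forall i, C i = set0 \/ standard (tau i) (C i)) ->
  (forall n, C (s n) !=set0) ->
  {homo (tau \o s) : m n / m < n} ->
  exists D, sum_of A D /\ forall n, standard (tau (s n)) (D n).
Proof.
move=> [Cp Acov] Ctau Cs smono.
have s_inj : injective s.
  by move=> m n mn; case: (ltngtP m n) => // /smono; rewrite /= mn ltnn.
have tau_ge n : n <= tau (s n).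
  elim: n => // n IH; apply: leq_ltn_trans IH _; exact: (smono n n.+1).
have /choice[r rP] : forall i, exists n, s n = i \/
    (~ range s i /\ tau i < tau (s n)).
  move=> i; have [[n _ <-]|ni] := pselect (range s i); first by exists n; left.
  exists (tau i).+1; right; split=> //; exact: tau_ge.
have rs n : r (s n) = n.
  have [/s_inj//|[h _]] := rP (s n); by case: h; exists n.
exists (fun n => [set y | exists2 i, r i = n & C i y]); split.
  split; first exact: pieces_group.
  by move=> y /Acov[i iy]; exists (r i), i.
move=> n; apply: (standard_absorbing (i0 := s n) (sum_of_fiber r n Cp)).
  rewrite (_ : mkset _ = C (s n)); last by apply/seteqP; split=> y //= [].
  by have [e|//] := Ctau (s n); have := Cs n; rewrite e => -[].
move=> i isn; have [rin|rin] := pselect (r i = n); last first.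
  by left; apply/seteqP; split=> y //= [].
rewrite (_ : mkset _ = C i); last by apply/seteqP; split=> y //= [].
have [->|h] := Ctau i; first exact: lower_standard0.
right; exists (tau i) => //.
by have [e|[_]] := rP i; [rewrite -e rin in isn|rewrite rin].
Qed.

(** Once a subsequence of pieces of [A] with increasing types is chosen, [B]
    can be regrouped along the same types, because it has a piece of each type. *)
Lemma unbounded_sums_homs A B (C D : nat -> set T) (tau : nat -> nat) :
  sum_of A C -> (forall i, C i = set0 \/ standard (tau i) (C i)) ->
  (forall m, exists2 i, m <= tau i & C i !=set0) ->
  sum_of B D -> (forall k, standard k (D k)) ->
  homs A B.
Proof.
move=> Asum Ctau Cub Bsum Dtyp.
have /choice[u uP] : forall m, exists i, m <= tau i /\ C i !=set0.
  by move=> m; have [i] := Cub m; exists i.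
have [s [sC smono]] : exists s : nat -> nat,
    (forall n, C (s n) !=set0) /\ {homo (tau \o s) : m n / m < n}.
  exists (fix s n := if n is m.+1 then u (tau (s m)).+1 else u 0); split.
    by move=> [|n]; exact: (uP _).2.
  by apply: (homo_ltn ltn_trans) => n; exact: (uP _).1.
have [A' [A'sum A'standard]] := sum_regroup Asum Ctau sC smono.
have [B' [B'sum B'standard]] := @sum_regroup B D id (tau \o s) Bsum
  (fun k => or_intror (Dtyp k)) (fun n => standard_neq0 (Dtyp _)) smono.
apply: (sum_homs A'sum B'sum) => n; exact: standard_homs (A'standard n) (B'standard n).
Qed.

End Homeomorphism.

(** * Cantor-Bendixson derivatives of standard sets *)

Section Rank.
Context {T : topologicalType}.
Implicit Types A C : set T.

Definition derived A : set T := A `\` isolated A.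

Lemma rel_open_isolated A C x :
  rel_open A C -> C x -> isolated A x <-> isolated C x.
Proof.
move=> [CA Co] Cx; split=> -[_ [V nV VE]].
  split; first exact: mem_set.
  exists V => //; apply/seteqP; split=> y; last first.
    by move=> ->; split=> //; exact: nbhs_singleton.
  by move=> [Vy /CA Ay]; rewrite -VE.
split; first exact/mem_set/CA.
exists (V `&` [set y | A y -> C y]); first exact: filterI (Co x Cx).
apply/seteqP; split=> y; last first.
  move=> ->; split; last exact: CA.
  by split=> //; exact: nbhs_singleton.
by move=> [[Vy yC] /yC Cy]; rewrite -VE.
Qed.

Lemma derived_sub A : derived A `<=` A. Proof. by move=> x []. Qed.

Lemma iter_derived_sub m A : iter m derived A `<=` A.
Proof. by elim: m => //= m IH x /derived_sub/IH. Qed.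

Lemma rel_open_derived A C : rel_open A C -> derived C = derived A `&` C.
Proof.
move=> Co; apply/seteqP; split=> x.
  move=> [Cx nC]; split=> //; split; first exact: Co.1.
  by rewrite (rel_open_isolated Co).
by move=> [[Ax nA] Cx]; split=> //; rewrite -(rel_open_isolated Co).
Qed.

Lemma rel_open_iter_derived m A C :
  rel_open A C -> iter m derived C = iter m derived A `&` C.
Proof.
move=> Co; elim: m => [|m IH] /=.
  by apply/seteqP; split=> [x Cx|x []//]; split=> //; exact: Co.1.
have h : rel_open (iter m derived A) (iter m derived C).
  rewrite IH; apply: rel_open_setI Co; exact: iter_derived_sub.
rewrite (rel_open_derived h) IH; apply/seteqP; split=> x.
  by move=> [dx [_ Cx]].
by move=> [dx Cx]; split=> //; split=> //; exact: derived_sub dx.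
Qed.

(** Every neighbourhood of the apex contains a whole piece, since the set of all
    sequences is somewhere dense; so the apex survives as long as the pieces
    do, and one step longer. *)
Lemma standard_derived k A : standard k A ->
  (forall m, m <= k -> iter m derived A !=set0) /\ iter k.+1 derived A = set0.
Proof.
elim: k A => [|k IH] A.
  move=> [x ->]; split=> [[|//] _|]; first by exists x.
  apply/seteqP; split=> y //= [-> []]; split; first exact: mem_set.
  by exists setT; [exact: filterT|rewrite setTI].
move=> [x [C [cA typC]]]; have [[Cd Co] Ax Acov xN An Acvg] := cA.
have dC m p : iter m derived (C p) = iter m derived A `&` C p.
  exact: rel_open_iter_derived.
have dx m : m <= k.+1 -> iter m derived A x.
  elim: m => //= m IHm mk; split; first exact/IHm/ltnW.
  move=> [_ [V nV VE]].
  have [p Vp] : exists p, C p `<=` V.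
    apply: contrapT => nex; apply: (Acvg _ nV); apply: sub_somewhere_dense somewhere_dense_setT => p _.
    by exists p => //= h; apply: nex; exists p.
  have [y] := (IH _ (typC p)).1 m mk; rewrite dC => -[dy Cy].
  have : [set x] y by rewrite -VE; split=> //; exact: Vp.
  by move=> yx; rewrite yx in Cy; case: (xN p).
split=> [m /dx|]; first by exists x.
have d1 : iter k.+1 derived A = [set x].
  apply/seteqP; split=> y; last by move=> ->; exact: dx.
  move=> dy; have [//|[p py]] := Acov _ (iter_derived_sub dy).
  have : iter k.+1 derived (C p) y by rewrite dC.
  by rewrite (IH _ (typC p)).2.
rewrite iterS d1; apply/seteqP; split=> y //= [-> []]; split; first exact: mem_set.
by exists setT; [exact: filterT|rewrite setTI].
Qed.

Lemma sum_iter_derived (I : Type) m A (C : I -> set T) : sum_of A C ->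
  iter m derived A = \bigcup_i iter m derived (C i).
Proof.
move=> [[Cd Co] Acov]; apply/seteqP; split=> x.
  move=> dx; have [i ix] := Acov _ (iter_derived_sub dx).
  by exists i => //; rewrite (rel_open_iter_derived m (Co i)).
by move=> [i _]; rewrite (rel_open_iter_derived m (Co i)) => -[].
Qed.

End Rank.

(** * Passage to subspaces *)

Section Subspace.
Context {T : topologicalType} (B : set T).
Implicit Types (A C : set T) (x : set_type B).

Lemma nbhs_set_type x (V : set (set_type B)) :
  nbhs x V <-> exists2 U, nbhs (set_val x) U & set_val @^-1` U `<=` V.
Proof.
split=> [|[U nU UV]]; last first.
  by apply: (filterS UV); exact: (@initial_continuous _ _ (@set_val _ B) x U nU).
rewrite {1}nbhsE => -[O [[U oU <-] Ux] OV]; exists U => //.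
by exists U.
Qed.

Lemma rel_open_set_type A C : rel_open A C ->
  rel_open (set_val @^-1` A : set (set_type B)) (set_val @^-1` C).
Proof.
move=> [CA Co]; split=> [x /CA//|x /Co nx].
by apply/nbhs_set_type; exists [set y | A y -> C y].
Qed.

Lemma sum_of_set_type (I : Type) A (C : I -> set T) : sum_of A C ->
  sum_of (set_val @^-1` A : set (set_type B)) (fun i => set_val @^-1` C i).
Proof.
move=> [[Cd Co] Acov]; split; [split|].
- by move=> i j x; exact: Cd.
- by move=> i; exact: rel_open_set_type.
- by move=> x; exact: Acov.
Qed.

Lemma standard_set_type k A : A `<=` B -> standard k A ->
  standard k (set_val @^-1` A : set (set_type B)).
Proof.
elim: k A => [|k IH] A AB.
  move=> [a aA]; have Ba : B a by apply: AB; rewrite aA.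
  exists (SigSub (mem_set Ba)); rewrite aA; apply/seteqP; split=> y /=.
    by move=> ya; apply: val_inj.
  by move=> ->.
move=> [a [C [[[Cd Co] Aa Acov aC An Acvg] typC]]].
have CA p : C p `<=` A := (Co p).1.
exists (SigSub (mem_set (AB _ Aa))), (fun p => set_val @^-1` C p); split; last first.
  by move=> p; apply: IH (typC p) => y /CA/AB.
split=> //.
- by split=> [p q y|p]; [exact: Cd|exact: rel_open_set_type].
- by move=> y /Acov[ya|]; [left; exact: val_inj|right].
- move=> N nN; apply/nbhs_set_type; eexists; first exact: An nN.
  by move=> y h /h[ya|]; [left; exact: val_inj|right].
- move=> V /nbhs_set_type[U nU UV]; apply: nowhere_dense_sub (Acvg _ nU).
  move=> _ [p h <-]; exists p => // CU; apply: h => y /CU; exact: UV.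
Qed.

Lemma image_derived (D : set (set_type B)) :
  set_val @` derived D = derived (set_val @` D).
Proof.
have iso x : D x -> isolated D x <-> isolated (set_val @` D) (set_val x).
  move=> Dx; split=> -[_ [V nV VE]].
    split; first by apply/mem_set; exists x.
    have /nbhs_set_type[U nU UV] := nV.
    exists U => //; apply/seteqP; split=> [z [Uz [y Dy yz]]|z ->]; last first.
      by split; [exact: nbhs_singleton|exists x].
    have : [set x] y by rewrite -VE; split=> //; apply: UV; rewrite /= yz.
    by move=> yx; rewrite -yz yx.
  split; first exact: mem_set.
  exists (set_val @^-1` V); first by apply/nbhs_set_type; exists V.
  apply/seteqP; split=> [y [Vy Dy]|y ->].
    apply: val_inj; suff : [set set_val x] (set_val y) by [].
    by rewrite -VE; split=> //; exists y.
  by split=> //=; exact: nbhs_singleton.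
apply/seteqP; split=> [_ [x [Dx nx] <-]|_ [[x Dx <-] nx]].
  by split; [exists x|rewrite -iso].
by exists x => //; split=> //; rewrite iso.
Qed.

Lemma image_iter_derived m :
  set_val @` iter m derived [set: set_type B] = iter m derived B.
Proof.
elim: m => [|m IH] /=; last by rewrite image_derived IH.
apply/seteqP; split=> [_ [x _ <-]|x Bx]; first exact: set_valP.
by exists (SigSub (mem_set Bx)).
Qed.

Lemma iter_derived_set_type m :
  iter m derived [set: set_type B] = set0 <-> iter m derived B = set0.
Proof.
rewrite -image_iter_derived; split=> [->|/image_set0_set0//]; exact: image_set0.
Qed.

End Subspace.

Lemma homs_homeomorphic (X : topologicalType) (A : set X) :
  homs [set: X] A -> homeomorphic X (set_type A).
Proof.
move=> [f [g [fg gf]]].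
have Af x : A (f x) by have [] := fg x.
exists (fun x => SigSub (mem_set (Af x))), (fun y => g (set_val y)); split.
- by move=> x /=; have [] := fg x.
- move=> y; apply: val_inj => /=; have [] := gf (set_val y) => //; exact: set_valP.
- move=> x V /nbhs_set_type[U nU UV].
  have [_ _ /(_ _ nU)] := fg x I; apply: filterS => y /(_ I) Uy.
  exact: (UV (SigSub (mem_set (Af y)))).
- move=> y V nV; apply/nbhs_set_type.
  have [_ _ /(_ _ nV) h] := gf (set_val y) (set_valP y).
  by exists [set z | A z -> V (g z)] => // z; apply; exact: set_valP.
Qed.

(** * Ordinals up to omega *)

Section Ordinals.
Local Open Scope order_scope.
Import Order.TTheory.
Context {d : Order.disp_t} {W : orderType d} (wfW : wf_order W).

Lemma wf_least (P : set W) : P !=set0 -> exists2 x, P x & forall y, P y -> x <= y.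
Proof.
move=> [x0 Px0]; apply: contrapT => nex.
suff : forall x, ~ P x by move/(_ x0).
apply: (well_founded_ind wfW) => x IH Px; apply: nex; exists x => // y Py.
by rewrite leNgt; apply/negP => /IH.
Qed.

Fixpoint finite_ordinal (m : nat) (a : W) : Prop :=
  if m is m'.+1 then exists2 b, finite_ordinal m' b & is_succ b a else is_zero a.

Lemma cb_derivative_finite X m a :
  finite_ordinal m a -> cb_derivative wfW X a = iter m derived setT.
Proof.
elim: m a => [|m IH] a /=; first exact: cb_derivative0.
by move=> [b /IH <- /cb_derivativeS].
Qed.

Lemma nonzero_lt a : ~ is_zero a -> exists b : W, b < a.
Proof.
move=> /existsNP[b /negP]; rewrite -ltNge; by exists b.
Qed.

(** The values of an increasing map to the naturals on the predecessors of [b] are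
    bounded, so a nonzero [b] has a largest predecessor. *)
Lemma le_omega_finite (n : W) : ordinal_le n nat ->
  forall b, b < n -> exists m, finite_ordinal m b.
Proof.
move=> [f fmono]; apply: (well_founded_ind wfW) => b IH bn.
have [b0|/nonzero_lt[c0 c0b]] := pselect (is_zero b); first by exists 0.
pose Q k := `[< exists2 c, c < b & f c = k >].
have exQ : exists k, Q k by exists (f c0); apply/asboolP; exists c0.
have ubQ k : Q k -> (k <= f b)%N.
  by move=> /asboolP[c cb <-]; exact/ltnW/fmono.
case: (ex_maxnP exQ ubQ) => k /asboolP[c cb <-] cmax.
have [m mc] := IH c cb (lt_trans cb bn).
exists m.+1, c => //; split=> // e ce; rewrite leNgt; apply/negP => eb.
have : (f e <= f c)%N by apply: cmax; apply/asboolP; exists e.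
by rewrite leqNgt => /negP; apply; apply: fmono => //; exact: lt_trans bn.
Qed.

Lemma finite_ordinal_below m (n b : W) :
  finite_ordinal m n -> b < n ->
  exists2 m', (m' < m)%N & finite_ordinal m' b.
Proof.
elim: m n => [|m IH] n /=; first by move=> /(_ b); rewrite leNgt => /negP.
move=> [c mc [cn csucc]] bn.
have : b <= c by rewrite leNgt; apply/negP => /csucc; rewrite leNgt bn.
rewrite le_eqVlt => /predU1P[->|bc]; first by exists m.
by have [m' m'm m'b] := IH c mc bc; exists m' => //; exact: ltnW.
Qed.

Lemma finite_ordinal_above m m' (n : W) :
  finite_ordinal m n -> (m' < m)%N ->
  exists2 b, b < n & finite_ordinal m' b.
Proof.
elim: m n => [//|m IH] n [c mc [cn _]].
rewrite ltnS leq_eqVlt => /predU1P[->|m'm]; first by exists c.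
by have [b bc m'b] := IH c mc m'm; exists b => //; exact: lt_trans cn.
Qed.

Lemma limit_finite_ordinal (n : W) : is_limit n ->
  forall m, exists2 b, b < n & finite_ordinal m b.
Proof.
move=> [n0 nS]; elim=> [|m [b bn mb]].
  have [c cn] := nonzero_lt n0.
  have [z _ zmin] := wf_least (ex_intro [set: W] c I).
  exists z; first by apply: le_lt_trans cn; exact: zmin.
  by move=> b; exact: zmin.
have [c bc cn] : exists2 c, b < c & c < n.
  apply: contrapT => nex; apply: (nS b); split=> // c bc; rewrite leNgt.
  by apply/negP => cn; apply: nex; exists c.
have [e be emin] := wf_least (ex_intro [set c | b < c] c bc).
by exists e; [exact: le_lt_trans (emin _ bc) cn|exists b].
Qed.

Lemma cb_rank_finite X m (n : W) : finite_ordinal m n ->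
  cb_rank_is wfW X n <->
  iter m derived [set: X] = set0 /\
  forall m', (m' < m)%N -> iter m' derived [set: X] <> set0.
Proof.
move=> mn; rewrite /cb_rank_is (cb_derivative_finite X mn); split=> -[h h'].
  split=> // m' /(finite_ordinal_above mn)[b bn /(cb_derivative_finite X) <-]; exact: h'.
split=> // b /(finite_ordinal_below mn)[m' m'm /(cb_derivative_finite X) ->]; exact: h'.
Qed.

Lemma cb_rank_limit X (n : W) : ordinal_le n nat -> is_limit n ->
  cb_rank_is wfW X n <->
  \bigcap_m iter m derived [set: X] = set0 /\
  forall m, iter m derived [set: X] <> set0.
Proof.
move=> nle nlim; rewrite /cb_rank_is (cb_derivative_limit wfW X nlim).
have -> : \bigcap_(b in [set b | b < n]) cb_derivative wfW X b =
    \bigcap_m iter m derived [set: X].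
  apply/seteqP; split=> x h.
    move=> m _; have [b bn mb] := limit_finite_ordinal nlim m.
    by rewrite -(cb_derivative_finite X mb); exact: h.
  move=> b bn; have [m mb] := le_omega_finite nle bn.
  by rewrite (cb_derivative_finite X mb); exact: h.
split=> -[h h']; split=> //.
  by move=> m; have [b bn mb] := limit_finite_ordinal nlim m; rewrite -(cb_derivative_finite X mb); exact: h'.
by move=> b bn; have [m mb] := le_omega_finite nle bn; rewrite (cb_derivative_finite X mb); exact: h'.
Qed.

Lemma le_omega_cases (n : W) : ordinal_le n nat ->
  (exists m, finite_ordinal m n) \/ is_limit n.
Proof.
move=> nle; have [|nex] := pselect (exists m, finite_ordinal m n); [by left|right].
split=> [n0|b bn]; first by apply: nex; exists 0.
have [m mb] := le_omega_finite nle bn.1.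
by apply: nex; exists m.+1, b.
Qed.

End Ordinals.

(** * A model of the standard spaces *)

(** The tree of finite sequences of indices, where each node is the apex of a cone
    over the subtrees at its children.  Truncating the tree above a node at
    height [k] gives a standard set of type [k]. *)
Definition nodes : Type := seq (seq nat).
HB.instance Definition _ := Countable.on nodes.

Definition nodes_open (U : set nodes) : Prop :=
  forall s, U s -> ~ somewhere_dense [set p | exists t, ~ U (s ++ p :: t)].

Lemma nodes_openT : nodes_open setT.
Proof. by move=> s _ [r /(_ [::])[w [t]]] []. Qed.

Lemma nodes_openI (U V : set nodes) :
  nodes_open U -> nodes_open V -> nodes_open (U `&` V).
Proof.
move=> oU oV s [/oU Us /oV Vs]; apply: nowhere_dense_sub (nowhere_denseU Us Vs) => p [t].
by move=> /not_andP[] nt; [left|right]; exists t.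
Qed.

Lemma nodes_open_bigcup (I : Type) (f : I -> set nodes) :
  (forall i, nodes_open (f i)) -> nodes_open (\bigcup_i f i).
Proof.
move=> fo s [i _ /(fo i)]; apply: nowhere_dense_sub => p [t nt]; exists t => fit.
by apply: nt; exists i.
Qed.

HB.instance Definition _ :=
  isOpenTopological.Build nodes nodes_openT nodes_openI nodes_open_bigcup.

Lemma open_nodes (U : set nodes) : open U = nodes_open U.
Proof. by []. Qed.

Definition above (s : nodes) : set nodes := [set u | exists t, u = s ++ t].

Lemma open_above s : open (above s).
Proof.
rewrite open_nodes => _ [t ->]; apply: nowhere_dense_sub (@somewhere_dense_set0) => p [t' []].
by exists (t ++ p :: t'); rewrite catA.
Qed.

(** Outside the subtree at [s], a node has at most one child whose
    subtree meets it, and a singleton is nowhere dense. *)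
Lemma open_aboveC s : open (~` above s).
Proof.
rewrite open_nodes => u us.
apply: nowhere_dense_sub (@somewhere_dense_set1 (nth [::] s (size u))) => p [t /contrapT[v e]].
have [su|us'] := leqP (size s) (size u).
  case: us; exists (drop (size s) u).
  have := congr1 (take (size s)) e; rewrite takel_cat // take_size_cat // => us.
  by rewrite -{1}(cat_take_drop (size s) u) us.
have := congr1 (fun x => nth [::] x (size u)) e.
by rewrite !nth_cat ltnn subnn us'.
Qed.

Lemma nodes_hausdorff (B : set nodes) : hausdorff_space (set_type B).
Proof.
move=> x y xy; apply: val_inj; apply: contrapT => nxy.
have sep (a b : set_type B) : ~ above (set_val a) (set_val b) ->
    exists U V, [/\ nbhs a U, nbhs b V & U `&` V = set0].
  move=> ab; exists (set_val @^-1` above (set_val a)), (set_val @^-1` (~` above (set_val a))).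
  split; last by apply/seteqP; split=> z [].
  - apply/nbhs_set_type; eexists; last exact: subset_refl.
    by apply: open_nbhs_nbhs; split; [exact: open_above|exists [::]; rewrite cats0].
  - apply/nbhs_set_type; eexists; last exact: subset_refl.
    by apply: open_nbhs_nbhs; split; [exact: open_aboveC|].
have [[t yE]|/sep[U [V [nU nV UV]]]] := pselect (above (set_val x) (set_val y)); last first.
  by have [z] := xy _ _ nU nV; rewrite UV.
have [[t' xE]|/sep[U [V [nU nV UV]]]] := pselect (above (set_val y) (set_val x)); last first.
  by have [z] := xy _ _ nV nU; rewrite setIC UV.
suff : set_val x = set_val y by [].
rewrite yE; case: t yE => [|p t] yE; first by rewrite cats0.
by have := congr1 size xE; rewrite yE !size_cat /=; lia.
Qed.

Definition truncated (k : nat) (s : nodes) : set nodes :=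
  [set u | exists2 t, size t <= k & u = s ++ t].

Lemma truncated_above k s : truncated k s `<=` above s.
Proof. by move=> _ [t _ ->]; exists t. Qed.

Lemma rel_open_above (A C : set nodes) s :
  A `&` above s `<=` C -> C `<=` above s -> C `<=` A -> rel_open A C.
Proof.
move=> AC Cs CA; split=> // x Cx.
have : nbhs x (above s) by apply: open_nbhs_nbhs; split; [exact: open_above|exact: Cs].
by apply: filterS => y sy Ay; exact: AC.
Qed.

Lemma above_rcons_inj (s u : nodes) p q :
  above (rcons s p) u -> above (rcons s q) u -> p = q.
Proof.
move=> [t ->] [t']; rewrite !cat_rcons => /eqP.
by rewrite eqseq_cat // eqxx /= eqseq_cons => /andP[/eqP].
Qed.

Lemma standard_truncated k s : standard k (truncated k s).
Proof.
elim: k s => [|k IH] s.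
  exists s; apply/seteqP; split=> [_ [[|//] _ ->]|_ ->]; first by rewrite cats0.
  by exists [::]; rewrite ?cats0.
exists s, (fun p => truncated k (rcons s p)); split=> //.
have cover u : truncated k.+1 s u -> u = s \/ exists2 p, truncated k (rcons s p) u &
    exists t, u = s ++ p :: t.
  move=> [[|p t] tk ->]; first by left; rewrite cats0.
  right; exists p; last by exists t.
  by exists t; rewrite ?cat_rcons.
split.
- split=> [p q u /truncated_above pu /truncated_above|p]; first exact: above_rcons_inj.
  apply: (@rel_open_above _ _ (rcons s p)).
  + move=> u [[t' tk ->] [t e]]; exists t => //; move: e.
    by rewrite cat_rcons => /eqP; rewrite eqseq_cat // eqxx => /eqP te; rewrite te in tk.
  + exact: truncated_above.
  + by move=> _ [t tk ->]; exists (p :: t); rewrite ?cat_rcons.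
- by exists [::]; rewrite ?cats0.
- by move=> u /cover[|[p pu _]]; [left|right; exists p].
- by move=> p [t _ /(congr1 size)]; rewrite size_cat size_rcons; lia.
- move=> N nN.
  pose U := [set u : nodes | u = s \/ exists p t, ~ N p /\ u = s ++ p :: t].
  have Uo : open U.
    rewrite open_nodes => u [->|[p [t [Np ->]]]].
      apply: nowhere_dense_sub nN => p [t h]; apply: contrapT => Np; apply: h; right.
      by exists p, t.
    apply: nowhere_dense_sub somewhere_dense_set0 => q [t' []]; right.
    by exists p, (t ++ q :: t'); rewrite -catA.
  have : nbhs s U by apply: open_nbhs_nbhs; split=> //; left.
  apply: filterS => u Uu /cover[us|[p pu [t ut]]]; [by left|right].
  exists p => //; case: Uu => [us|[q [t' [Nq]]]].
    by have := congr1 size ut; rewrite us size_cat /=; lia.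
  by rewrite ut => /eqP; rewrite eqseq_cat // eqxx /= eqseq_cons => /andP[/eqP ->].
- move=> V; rewrite {1}nbhsE => -[U [Uo Us] UV]; rewrite image_id.
  apply: nowhere_dense_sub (Uo _ Us) => p /= /existsNP[_ /not_implyP[[t _ ->] nV]].
  by exists t => h; apply: nV; apply: UV; rewrite cat_rcons.
Qed.

(** One standard set of each type, at pairwise distinct children of the root; the
    root itself is left out. *)
Definition bouquet : set nodes := [set u | exists k, truncated k [:: [:: k]] u].

Lemma sum_bouquet : sum_of bouquet (fun k => truncated k [:: [:: k]]).
Proof.
split=> //; split=> [k l u /truncated_above ku /truncated_above lu|k].
  by have [] := @above_rcons_inj [::] u [:: k] [:: l] ku lu.
apply: (@rel_open_above _ _ [:: [:: k]]).
- move=> u [[l lu] ku].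
  by have [->] := @above_rcons_inj [::] u [:: k] [:: l] ku (truncated_above lu).
- exact: truncated_above.
- by move=> u ku; exists k.
Qed.

(** * Toronto property *)

(** By [standard_sub] a subspace that is not standard of type [m] is a sum of
    standard sets of smaller type, whose rank is too small. *)
Lemma finite_toronto (d : Order.disp_t) (W : orderType d) (wfW : wf_order W)
    (n : W) (X : topologicalType) m :
  finite_ordinal m.+1 n -> standard m [set: X] ->
  toronto wfW n X.
Proof.
move=> mn typX.
have rankX : cb_rank_is wfW X n.
  apply/(cb_rank_finite _ _ mn); have [h h'] := standard_derived typX.
  by split=> // m' m'm; apply/eqP/set0P; exact: h.
split=> //; first by exists d, W, wfW, n; case: rankX.
move=> A /(cb_rank_finite _ _ mn)[_ /(_ m (leqnn _))].
rewrite iter_derived_set_type => dA; apply: homs_homeomorphic.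
have [typA|[C [Csum Clow]]] := standard_sub typX (@subsetT _ A); first exact: standard_homs typX typA.
case: dA; rewrite (sum_iter_derived _ Csum); apply: bigcup0 => i _.
have [->|[j jm /standard_derived[_ h]]] := Clow i.
  by apply/seteqP; split=> x // /iter_derived_sub.
by rewrite -(subnK jm) iterD h; apply/seteqP; split=> x // /iter_derived_sub.
Qed.

(** A subspace of rank [omega] is a countable sum of standard sets, whose types are
    unbounded because no finite derivative of it is empty. *)
Lemma omega_toronto (d : Order.disp_t) (W : orderType d) (wfW : wf_order W)
    (n : W) (X : topologicalType) (D : nat -> set X) :
  ordinal_le n nat -> is_limit n ->
  sum_of [set: X] D -> (forall k, standard k (D k)) -> toronto wfW n X.
Proof.
move=> nle nlim Dsum typD.
have dlow (B : set X) k m : lower_standard k B -> k <= m -> iter m derived B = set0.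
  move=> [->|[j jk /standard_derived[_ h]]] km.
    by apply/seteqP; split=> x // /iter_derived_sub.
  rewrite -(subnK (leq_trans jk km)) iterD h.
  by apply/seteqP; split=> x // /iter_derived_sub.
have rankX : cb_rank_is wfW X n.
  apply/(cb_rank_limit wfW X nle nlim); split.
    apply/seteqP; split=> // x dx; have [k kx] := Dsum.2 x I.
    have := dx k.+1 I; have := rel_open_iter_derived k.+1 (Dsum.1.2 k).
    have [_ ->] := standard_derived (typD k).
    by move=> /seteqP[_ h] kd; apply: (h x).
  move=> m; rewrite (sum_iter_derived _ Dsum) => /seteqP[h _].
  have [x mx] := (standard_derived (typD m)).1 m (leqnn m).
  by apply: (h x); exists m.
split=> //; first by exists d, W, wfW, n; case: rankX.
move=> A /(cb_rank_limit wfW _ nle nlim)[_ dA]; apply: homs_homeomorphic.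
have /choice[C CP] : forall k, lower_sum k.+1 (A `&` D k).
  move=> k; have [|] := standard_sub (typD k) (@subIsetr _ A (D k)).
    exact: standard_small_sum.
  exact/lower_sum_leq/leqnSn.
have Fsum : sum_of A (fun i : nat * nat => C i.1 i.2).
  split=> [|x Ax].
    apply: pieces_pieces (pieces_setI (@subsetT _ A) Dsum.1) _ => k.
    exact: (CP k).1.1.
  have [k kx] := Dsum.2 x I.
  by have [i ix] := (CP k).1.2 x (conj Ax kx); exists (k, i).
have [G [Gsum Gtyp]] : exists G : nat -> set X, sum_of A G /\
    forall i, G i = set0 \/ exists j, standard j (G i).
  apply: (sum_of_nat (P := fun B => B = set0 \/ exists j, standard j B) _ Fsum); first by left.
  by move=> [k i]; have [|[j _ tj]] := (CP k).2 i; [left|right; exists j].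
have /choice[tau tauP] : forall i, exists j, G i = set0 \/ standard j (G i).
  by move=> i; have [->|[j]] := Gtyp i; [exists 0; left|exists j; right].
suff : homs A [set: X] by move=> [f [g [fg gf]]]; exists g, f.
apply: (unbounded_sums_homs Gsum tauP _ Dsum typD) => m.
apply: contrapT => nex; apply: (dA m); rewrite iter_derived_set_type.
rewrite (sum_iter_derived _ Gsum); apply: bigcup0 => i _.
apply: (dlow _ m) => //; have [->|typi] := tauP i; first exact: lower_standard0.
right; exists (tau i) => //; rewrite ltnNge; apply/negP => mi; apply: nex.
by exists i => //; exact: standard_neq0 typi.
Qed.

Unset Implicit Arguments.
Set Strict Implicit.

Theorem corollary3p2 (d : Order.disp_t) (W : orderType d) (wfW : wf_order W)
    (n : W) (n_le_omega : ordinal_le n nat) :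
  exists X : topologicalType,
    [/\ countable [set: X], hausdorff_space X & toronto wfW n X].
Proof.
suff [B BT] : exists B : set nodes, toronto wfW n (set_type B).
  exists (set_type B); split=> //; last exact: nodes_hausdorff.
  exact: countableP.
have preimageB (B : set nodes) : set_val @^-1` B = [set: set_type B].
  by apply/seteqP; split=> // x _; exact: set_valP.
have [[[|m] mn]|nlim] := le_omega_cases wfW n_le_omega.
- have rank0 (X : topologicalType) : cb_rank_is wfW X n <-> [set: X] = set0.
    rewrite (cb_rank_finite _ _ mn) /=; split=> [[]|] //.
  exists set0; have X0 : [set: set_type (@set0 nodes)] = set0.
    by apply/seteqP; split=> // x; have [] := set_valP x.
  split; [|exact/rank0|].
    by exists d, W, wfW, n; have /rank0[] := X0.
  move=> A /rank0 A0; apply: homs_homeomorphic; exists id, id.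
  by split=> x; have := set_valP x.
- exists (truncated m [::]); apply: (finite_toronto _ mn).
  by rewrite -preimageB; apply: standard_set_type => //; exact: standard_truncated.
- exists bouquet; apply: (omega_toronto _ n_le_omega nlim
    (D := fun k => set_val @^-1` truncated k [:: [:: k]])).
    by rewrite -preimageB; exact: sum_of_set_type sum_bouquet.
  move=> k; apply: standard_set_type; last exact: standard_truncated.
  by move=> u ku; exists k.
Qed.
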